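(* Let $p\in\mathbb{N}\setminus\{0\}$. There exist a two-player game $\mathcal{G}=(\mathcal{A},(\Omega_1,\Omega_2))$, where $\mathcal{A}$ is an arena with $2p+2$ vertices and $\Omega_1$ and $\Omega_2$ are both Büchi and co-Büchi objectives, and an initial vertex $v$ in $\mathcal{G}$ such that $P_2$ requires a memory of size at least $p$ in any Nash equilibrium from $v$ whose outcome satisfies $\Omega_2$.
   Context: Arenas. A two-player arena is $\mathcal{A}=((V_1,V_2),E)$ where $(V_1,V_2)$ is a partition of a set of vertices $V$ ($V_i$ is the set of vertices controlled by player $P_i$), $E\subseteq V\times V$, and every vertex has at least one $E$-successor. A play is an infinite sequence $v_0v_1\ldots$ with $(v_\ell,v_{\ell+1})\in E$ for all $\ell\in\mathbb{N}$; a history is a finite non-empty prefix of a play. Strategies. A strategy of $P_i$ is a function $\sigma_i$ mapping each history $h$ ending in $V_i$ to an $E$-successor of the last vertex of $h$. A play $v_0v_1\ldots$ is consistent with $\sigma_i$ if $v_\ell\in V_i$ implies $v_{\ell+1}=\sigma_i(v_0\ldots v_\ell)$ for all $\ell$. The outcome $\mathsf{Out}((\sigma_1,\sigma_2),v)$ of $(\sigma_1,\sigma_2)$ from $v$ is the unique play from $v$ consistent with $\sigma_1$ and $\sigma_2$. Mealy machines. A Mealy machine of $P_i$ is $(M,m_{\mathsf{init}},\mathsf{up},\mathsf{nxt}_i)$ with $M$ a finite set of memory states, $m_{\mathsf{init}}\in M$, $\mathsf{up}\colon M\times V\to M$ and $\mathsf{nxt}_i\colon M\times V_i\to V$. Let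 $\widehat{\mathsf{up}}(\varepsilon)=m_{\mathsf{init}}$ and $\widehat{\mathsf{up}}(wv)=\mathsf{up}(\widehat{\mathsf{up}}(w),v)$ for $w\in V^*$, $v\in V$. The machine induces the strategy $\sigma_i(h'v)=\mathsf{nxt}_i(\widehat{\mathsf{up}}(h'),v)$ for every history $h'v$ ending in $v\in V_i$ (with $h'\in V^*$ possibly empty). ''$P_2$ requires a memory of size at least $p$'' in a Nash equilibrium $(\sigma_1,\sigma_2)$ means that every Mealy machine inducing $\sigma_2$ (if any) has at least $p$ memory states. Objectives and equilibria. For $T\subseteq V$, the Büchi objective $\mathsf{B\ddot{u}chi}(T)$ is the set of plays $v_0v_1\ldots$ with $v_\ell\in T$ for infinitely many $\ell$, and the co-Büchi objective $\mathsf{coB\ddot{u}chi}(T)$ is the set of plays with $v_\ell\in T$ for only finitely many $\ell$. ''$\Omega_1$ and $\Omega_2$ are both Büchi and co-Büchi objectives'' means that, for each $i\in\{1,2\}$, as a set of plays of $\mathcal{A}$, $\Omega_i=\mathsf{B\ddot{u}chi}(T)=\mathsf{coB\ddot{u}chi}(T')$ for some $T,T'\subseteq V$. In $\mathcal{G}$ player $P_i$ has objective $\Omega_i$. A pair $(\sigma_1,\sigma_2)$ is a Nash equilibrium from $v$ if no player whose objective is not satisfied by $\mathsf{Out}((\sigma_1,\sigma_2),v)$ can obtain an outcome from $v$ satisfying their objective by unilaterally changing their strategy. *)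

(* Defs.v *)
From HB Require Import structures.
From mathcomp Require Import all_boot.
Set Implicit Arguments.
Unset Strict Implicit.
Unset Printing Implicit Defensive.

Inductive player := P1 | P2.

Record arena (V : finType) := Arena {
  ctrl : player -> {set V};
  edge : rel V;
  ctrl_partition : ctrl P2 = ~: ctrl P1;
  edge_total : forall v : V, exists u : V, edge v u
}.

Section Arenas.
Variables (V : finType) (A : arena V).
Implicit Types (pi : nat -> V) (v : V) (w h : seq V) (i : player).

Definition is_play pi : Prop := forall l : nat, edge A (pi l) (pi l.+1).

Definition history h : Prop :=
  exists pi (n : nat), is_play pi /\ h = mkseq pi n.+1.

(* The value of a strategy on a sequence that is not a history ending in V_i is
   junk, and is never used below. *)
Record strategy i := Strategy {
  choice :> seq V -> V;
  choice_edge : forall w v, history (rcons w v) -> v \in ctrl A i ->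
    edge A v (choice (rcons w v))
}.

Definition consistent i (sigma : strategy i) pi : Prop :=
  forall l : nat, pi l \in ctrl A i -> pi l.+1 = sigma (mkseq pi l.+1).

(* The pair (w, u) stands for the history w u, of length n.+1. *)
Fixpoint outcome_prefix (s1 : strategy P1) (s2 : strategy P2) v (n : nat)
    : seq V * V :=
  if n is n'.+1 then
    let: (w, u) := outcome_prefix s1 s2 v n' in
    (rcons w u, if u \in ctrl A P1 then s1 (rcons w u) else s2 (rcons w u))
  else ([::], v).

Definition outcome (s1 : strategy P1) (s2 : strategy P2) v : nat -> V :=
  fun n => (outcome_prefix s1 s2 v n).2.

Record mealy i := Mealy {
  mem_state : finType;
  m_init : mem_state;
  m_up : mem_state -> V -> mem_state;
  m_nxt : mem_state -> {v : V | v \in ctrl A i} -> V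
}.

Definition up_hat i (M : mealy i) w : mem_state M :=
  foldl (@m_up i M) (m_init M) w.

Definition induces i (M : mealy i) (sigma : strategy i) : Prop :=
  forall w (v : {v : V | v \in ctrl A i}), history (rcons w (val v)) ->
    sigma (rcons w (val v)) = m_nxt (up_hat M w) v.

Lemma history_path v w : path (edge A) v w -> history (v :: w).
Proof.
move=> pw.
pose succ u := odflt u [pick x | edge A u x].
have succP u : edge A u (succ u).
  rewrite /succ; case: pickP => [//|none].
  by have [x] := edge_total A u; rewrite none.
pose pi n := if n <= size w then nth v (v :: w) n
             else iter (n - size w) succ (last v w).
exists pi, (size w); split.
  move=> l; rewrite /pi; case: (ltngtP l (size w)) => [lt|gt|->].
  - by have /(pathP v) /(_ _ lt) := pw.
  - by rewrite subSn ?(ltnW gt) //= succP.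
  - by rewrite subSnn /= -last_nth succP.
apply: (@eq_from_nth _ v); first by rewrite size_mkseq.
by move=> j /= jw; rewrite nth_mkseq // /pi -ltnS jw.
Qed.

Lemma outcome_prefixE s1 s2 v n :
  (outcome_prefix s1 s2 v n).1 = mkseq (outcome s1 s2 v) n.
Proof.
elim: n => [//|n IH]; rewrite mkseqS -IH /= /outcome.
by case: (outcome_prefix s1 s2 v n).
Qed.

Lemma outcomeS s1 s2 v n (pi := outcome s1 s2 v) :
  pi n.+1 = if pi n \in ctrl A P1 then s1 (mkseq pi n.+1)
            else s2 (mkseq pi n.+1).
Proof.
rewrite mkseqS -outcome_prefixE /pi /outcome /=.
by case: (outcome_prefix s1 s2 v n).
Qed.

Lemma in_ctrl2 v : (v \in ctrl A P2) = (v \notin ctrl A P1).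
Proof. by rewrite ctrl_partition inE. Qed.

Lemma outcome_spec s1 s2 v :
  [/\ is_play (outcome s1 s2 v), outcome s1 s2 v 0 = v,
      consistent s1 (outcome s1 s2 v) & consistent s2 (outcome s1 s2 v)].
Proof.
set pi := outcome s1 s2 v.
have step n : history (mkseq pi n.+1) -> edge A (pi n) (pi n.+1).
  move=> hn; rewrite {2}/pi outcomeS -/pi.
  case: ifPn => c; rewrite mkseqS; apply: choice_edge; rewrite -?mkseqS //.
  by rewrite in_ctrl2.
have pathn n : path (edge A) v (mkseq (fun k => pi k.+1) n).
  elim: n => [//|n IH]; rewrite mkseqS rcons_path IH /=.
  have -> : last v (mkseq (fun k => pi k.+1) n) = pi n.
    by case: (n) => [//|k]; rewrite mkseqS last_rcons.
  apply: step; rewrite [mkseq _ _](_ : _ = v :: mkseq (fun k => pi k.+1) n).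
    exact: history_path.
  by rewrite /mkseq /= (iotaDl 1 0) -map_comp.
split=> // [n | n c | n].
- apply: step; rewrite [mkseq _ _](_ : _ = v :: mkseq (fun k => pi k.+1) n).
    exact: history_path.
  by rewrite /mkseq /= (iotaDl 1 0) -map_comp.
- by rewrite {1}/pi outcomeS -/pi c.
- by rewrite in_ctrl2 => /negbTE c; rewrite {1}/pi outcomeS -/pi c.
Qed.

Lemma outcome_uniq s1 s2 v pi :
    pi 0 = v -> consistent s1 pi -> consistent s2 pi ->
  pi =1 outcome s1 s2 v.
Proof.
move=> pi0 c1 c2 n.
suff E k : mkseq pi k.+1 = mkseq (outcome s1 s2 v) k.+1.
  have := congr1 (last v) (E n); by rewrite !mkseqS !last_rcons.
elim: k => [|k IH]; first by rewrite /mkseq /= pi0.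
rewrite mkseqS IH [RHS]mkseqS; congr rcons.
have Ek : pi k = outcome s1 s2 v k.
  by have := congr1 (last v) IH; rewrite !mkseqS !last_rcons.
rewrite outcomeS -Ek -IH; case: ifPn => c; first exact: c1.
by apply: c2; rewrite in_ctrl2.
Qed.

End Arenas.

Definition buchi (V : finType) (T : {set V}) (pi : nat -> V) : Prop :=
  forall n : nat, exists l : nat, n <= l /\ pi l \in T.

Definition cobuchi (V : finType) (T : {set V}) (pi : nat -> V) : Prop :=
  exists n : nat, forall l : nat, n <= l -> pi l \notin T.

Record game (V : finType) := Game {
  arena_of :> arena V;
  objective : player -> (nat -> V) -> Prop
}.

Section Games.
Variables (V : finType) (G : game V).

Definition is_buchi (i : player) : Prop :=
  exists T : {set V}, forall pi : nat -> V,
    is_play G pi -> (objective G i pi <-> buchi T pi).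

Definition is_cobuchi (i : player) : Prop :=
  exists T : {set V}, forall pi : nat -> V,
    is_play G pi -> (objective G i pi <-> cobuchi T pi).

Definition nash (v : V) (s1 : strategy G P1) (s2 : strategy G P2) : Prop :=
  (~ objective G P1 (outcome s1 s2 v) ->
     forall t1 : strategy G P1, ~ objective G P1 (outcome t1 s2 v)) /\
  (~ objective G P2 (outcome s1 s2 v) ->
     forall t2 : strategy G P2, ~ objective G P2 (outcome s1 t2 v)).

Definition requires_memory (i : player) (sigma : strategy G i) (p : nat) : Prop :=
  forall M : mealy G i, induces M sigma -> p <= #|mem_state M|.

End Games.

(* Main.v *)
(* The ladder v_0 u_0 v_1 u_1 ... v_(p-1) u_(p-1) t has two sinks, t and s.
   Player P1 owns every v_i and may drop from v_i to any u_j with j <= i;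
   player P2 owns every u_i and may climb to v_(i+1) (to t from u_(p-1)) or
   give up by moving to s.  P1 wants to avoid the sinks forever and P2 wants to
   reach t.  By counting steps, P2 can climb along the ladder and give up as
   soon as P1 drops, which is an equilibrium reaching t.  Conversely, fix an
   equilibrium reaching t in which P2 plays a Mealy machine.  If the machine
   were in the same state just before the first visits to u_i and to u_j, with
   i < j, then instead of entering u_j player P1 could drop to u_i and repeat
   the segment in between forever, which is a profitable deviation.  So these p
   memory states are pairwise distinct. *)
Require Import Defs.
From HB Require Import structures.
From mathcomp Require Import all_boot.
From mathcomp Require Import zify.
Set Implicit Arguments.
Unset Strict Implicit.
Unset Printing Implicit Defensive.

(** * Pumping plays against a Mealy machine, and absorbing sets *)

Section Plays.
Variables (V : finType) (A : arena V).
Implicit Types (pi : nat -> V) (T : {set V}).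

Lemma mkseq_last_inj pi w v n : rcons w v = mkseq pi n.+1 ->
  size w = n /\ v = pi n.
Proof. by rewrite mkseqS => /rcons_inj [-> ->]; rewrite size_mkseq. Qed.

(** [P1] copies [pi] as long as the history is a prefix of it; [s1] only supplies legal moves
    elsewhere. *)
Lemma consistent_outcome (s1 : strategy A P1) (s2 : strategy A P2) pi :
  is_play A pi -> consistent s2 pi ->
  exists t1 : strategy A P1, pi =1 outcome t1 s2 (pi 0).
Proof.
move=> play_pi cons2.
pose f w := if w == mkseq pi (size w) then pi (size w) else s1 w.
have f_edge w v : history A (rcons w v) -> v \in ctrl A P1 ->
    edge A v (f (rcons w v)).
  move=> hw cv; rewrite /f; case: eqP => [|_]; last exact: choice_edge.
  by rewrite size_rcons => /mkseq_last_inj [_ ->].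
exists (Strategy f_edge); apply: outcome_uniq => // l _ /=.
by rewrite /f size_mkseq eqxx.
Qed.

(** For [a < b], the index sequence 0, ..., b-1 followed by a, ..., b-1 repeated forever. *)
Fixpoint lasso a b n :=
  if n is n'.+1 then
    if (lasso a b n').+1 == b then a else (lasso a b n').+1
  else 0.

Lemma ltn_lasso a b n : a < b -> lasso a b n < b.
Proof.
move=> ab; elim: n => [|n IH] /=; first by lia.
by case: eqP => // /eqP ne; rewrite ltn_neqAle ne.
Qed.

Lemma lasso_consistent (s2 : strategy A P2) (M : mealy A P2) pi a b :
    induces M s2 -> is_play A pi -> consistent s2 pi -> a <= b ->
    pi b \in ctrl A P1 -> edge A (pi b) (pi a) ->
    up_hat M (mkseq pi a) = up_hat M (mkseq pi b.+1) ->
  is_play A (pi \o lasso a b.+1) /\ consistent s2 (pi \o lasso a b.+1).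
Proof.
move=> indM play_pi cons2 ab ctrl_b edge_ba eqM.
set rho := pi \o _.
have play_rho : is_play A rho.
  by move=> l; rewrite /rho /=; case: eqP => [[->]|_].
split=> // l ctrl_l.
(* The jump back to [a] preserves the memory state by [eqM], so the machine cannot tell [rho] from
   [pi]. *)
have up_rho n : up_hat M (mkseq rho n) = up_hat M (mkseq pi (lasso a b.+1 n)).
  elim: n => [//|n IH].
  rewrite mkseqS /up_hat foldl_rcons -/(up_hat M _) IH /rho /= /up_hat.
  by rewrite -foldl_rcons -mkseqS; case: eqP => // ->.
have hist k tau : is_play A tau -> history A (rcons (mkseq tau k) (tau k)).
  by move=> ptau; exists tau, k; rewrite mkseqS.
(* The jump leaves [pi b], a vertex of [P1], so it never replaces a move of [P2]. *)
have ne : ((lasso a b.+1 l).+1 == b.+1) = false.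
  apply/eqP => -[e]; move: ctrl_l.
  by rewrite in_ctrl2 /rho /= e ctrl_b.
have -> : rho l.+1 = pi (lasso a b.+1 l).+1 by rewrite /rho /= ne.
rewrite cons2 // !mkseqS.
rewrite (indM _ (Sub (rho l) ctrl_l)) ?(indM _ (Sub (rho l) ctrl_l)) ?up_rho //;
  exact: hist.
Qed.

Definition absorbing T := forall x y, edge A x y -> x \in T -> y \in T.

Lemma absorbing_after T pi m n : absorbing T -> is_play A pi ->
  m <= n -> pi m \in T -> pi n \in T.
Proof.
move=> absT play_pi /subnK <-; elim: (n - m) => // k IH /IH.
exact/absT/play_pi.
Qed.

(** Since [T] cannot be left, reaching it, visiting it infinitely often and eventually staying in it
    coincide. This makes both objectives Büchi and co-Büchi. *)
Lemma absorbing_buchi T pi : absorbing T -> is_play A pi ->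
  (exists n, pi n \in T) <-> buchi T pi.
Proof.
move=> absT play_pi; split=> [[n Tn] k | /(_ 0) [n [_ Tn]]]; last by exists n.
by exists (maxn n k); rewrite leq_maxr (absorbing_after _ _ (leq_maxl n k)).
Qed.

Lemma absorbing_cobuchiC T pi : absorbing T -> is_play A pi ->
  (exists n, pi n \in T) <-> cobuchi (~: T) pi.
Proof.
move=> absT play_pi; split=> -[n Tn]; exists n.
  by move=> l nl; rewrite inE negbK (absorbing_after _ _ nl).
by have := Tn n (leqnn n); rewrite inE negbK.
Qed.

Lemma absorbing_cobuchi T pi : absorbing T -> is_play A pi ->
  (forall n, pi n \notin T) <-> cobuchi T pi.
Proof.
move=> absT play_pi; split=> [noT | [k noT] n]; first by exists 0.
apply: contra (noT _ (leq_maxr n k)).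
exact/absorbing_after/leq_maxl.
Qed.

Lemma absorbing_buchiC T pi : absorbing T -> is_play A pi ->
  (forall n, pi n \notin T) <-> buchi (~: T) pi.
Proof.
move=> absT play_pi; split=> [noT n | noT n].
  by exists n; rewrite inE noT.
have [l [nl]] := noT n; rewrite inE; apply: contra.
exact: absorbing_after.
Qed.

End Plays.

(** * The ladder game *)

Section Ladder.
Variables (p : nat) (hp : 0 < p).

Definition ladder_vertex := ('I_p * bool + bool)%type.
Local Notation v_ i := (inl (i, false) : ladder_vertex).
Local Notation u_ i := (inl (i, true) : ladder_vertex).
Local Notation sink_t := (inr true : ladder_vertex).
Local Notation sink_s := (inr false : ladder_vertex).

Definition ladder_edge (x y : ladder_vertex) : bool :=
  match x, y with
  | inl (i, false), inl (j, true) => j <= i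
  | inl (i, true), inl (j, false) => val j == i.+1
  | inl (i, true), inr b => b ==> (i.+1 == p)
  | inr b, inr c => b == c
  | _, _ => false
  end.

Definition ladder_ctrl (i : player) : {set ladder_vertex} :=
  let U := [set x | if x is inl (_, true) then true else false] in
  if i is P2 then U else ~: U.

Lemma ladder_partition : ladder_ctrl P2 = ~: ladder_ctrl P1.
Proof. by rewrite /= setCK. Qed.

Lemma ladder_total x : exists y, ladder_edge x y.
Proof.
case: x => [[i [|]]|b]; [by exists sink_s | by exists (u_ i) => /= | ].
by exists (inr b) => /=.
Qed.

Definition ladder := Arena ladder_partition ladder_total.

Definition sinks : {set ladder_vertex} := [set sink_s; sink_t].

Definition ladder_objective (i : player) (pi : nat -> ladder_vertex) : Prop :=
  if i is P1 then forall n, pi n \notin sinks else exists n, pi n \in [set sink_t].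

Definition ladder_game := Game ladder ladder_objective.

Lemma absorbing_sinks : absorbing ladder sinks.
Proof. by move=> [[i [|]]|[|]] [[j [|]]|[|]]; rewrite !inE. Qed.

Lemma absorbing_t : absorbing ladder [set sink_t].
Proof. by move=> [[i [|]]|[|]] [[j [|]]|[|]]; rewrite !inE. Qed.

Lemma ladder_buchi_cobuchi i : is_buchi ladder_game i /\ is_cobuchi ladder_game i.
Proof.
case: i; split.
- exists (~: sinks) => pi; exact: (absorbing_buchiC absorbing_sinks).
- exists sinks => pi; exact: (absorbing_cobuchi absorbing_sinks).
- exists [set sink_t] => pi; exact: (absorbing_buchi absorbing_t).
- exists (~: [set sink_t]) => pi; exact: (absorbing_cobuchiC absorbing_t).
Qed.

Lemma card_ladder_vertex : #|{: ladder_vertex}| = 2 * p + 2.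
Proof. by rewrite card_sum card_prod card_ord card_bool mulnC. Qed.

(** * An equilibrium reaching [sink_t] *)

Definition v0 := v_ (Ordinal hp).

Definition climb (i : 'I_p) : ladder_vertex :=
  if insub i.+1 is Some j then v_ j else sink_t.

Lemma climb_edge i : ladder_edge (u_ i) (climb i).
Proof.
rewrite /climb; case: insubP => [j _ /= ->|] //=.
by rewrite -leqNgt eqn_leq ltn_ord.
Qed.

(** The sinks belong to [P1], whose move there is the loop. *)
Definition keep_choice (w : seq ladder_vertex) : ladder_vertex :=
  if last sink_s w is inl (i, false) then u_ i else last sink_s w.

Lemma keep_edge w x : history ladder (rcons w x) -> x \in ladder_ctrl P1 ->
  ladder_edge x (keep_choice (rcons w x)).
Proof.
rewrite /keep_choice last_rcons => _.
by case: x => [[i [|]]|b]; rewrite ?inE /=.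
Qed.

Definition keep : strategy ladder_game P1 := @Strategy _ ladder P1 _ keep_edge.

(* Without any drop, u_i is the last vertex of a history of length 2 i + 2. *)
Definition count_choice (w : seq ladder_vertex) : ladder_vertex :=
  if last sink_s w is inl (i, true) then
    if size w == i.*2.+2 then climb i else sink_s
  else sink_s.

Lemma count_edge w x : history ladder (rcons w x) -> x \in ladder_ctrl P2 ->
  ladder_edge x (count_choice (rcons w x)).
Proof.
rewrite /count_choice last_rcons => _.
case: x => [[i [|]]|b]; rewrite ?inE //= => _.
by case: eqP => // _; exact: climb_edge.
Qed.

Definition count : strategy ladder_game P2 := @Strategy _ ladder P2 _ count_edge.

Lemma climb_level i n : val i = n ->
  climb i = sink_t \/ exists2 j : 'I_p, val j = n.+1 & climb i = v_ j.
Proof.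
move=> <-; rewrite /climb; case: insubP => [j _ ej|_]; last by left.
by right; exists j.
Qed.

(** From [v_ n] at time 2n, [P1] moves to some [u_ j] with j <= n; [count] climbs only if j = n and
    answers a drop with [sink_s]. *)
Lemma count_invariant pi n : is_play ladder pi -> pi 0 = v0 ->
    consistent count pi ->
  pi n.*2 \in sinks \/ exists2 i : 'I_p, val i = n & pi n.*2 = v_ i.
Proof.
move=> play_pi pi0 cons2; elim: n => [|n [IH|[i ei IH]]].
- by right; exists (Ordinal hp).
- left; apply: (absorbing_after absorbing_sinks play_pi _ IH).
  by rewrite leq_double.
have := play_pi n.*2; rewrite IH doubleS.
case E : (pi n.*2.+1) => [[j [|]]|b] //= _.
rewrite cons2 ?E ?inE // /= /count_choice mkseqS last_rcons E.
rewrite size_rcons size_mkseq; case: (n.*2.+2 =P _) => [[e]|_]; last first.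
  by left.
have ej : val j = n by apply: double_inj; rewrite e.
have [->|[k ek ->]] := climb_level ej; first by left.
by right; exists k.
Qed.

Lemma count_punishes (t1 : strategy ladder_game P1) :
  ~ ladder_objective P1 (outcome t1 count v0).
Proof.
have [play_pi pi0 _ cons2] := outcome_spec t1 count v0.
(* By time 2p the ladder is exhausted: no element of ['I_p] has value [p]. *)
move=> /(_ p.*2); have [->//|[i]] := count_invariant p play_pi pi0 cons2.
by have := ltn_ord i => /[swap] -> ; rewrite ltnn.
Qed.

Lemma keep_count_invariant (pi := outcome keep count v0) n :
  pi n.*2 = sink_t \/ exists2 i : 'I_p, val i = n & pi n.*2 = v_ i.
Proof.
have [play_pi pi0 cons1 cons2] := outcome_spec keep count v0.
rewrite -/pi in play_pi pi0 cons1 cons2.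
elim: n => [|n [IH|[i ei IH]]]; first by right; exists (Ordinal hp).
  left; apply/set1P; apply: (absorbing_after absorbing_t play_pi (m := n.*2)).
    by rewrite leq_double.
  by rewrite IH inE.
have E : pi n.*2.+1 = u_ i.
  by rewrite cons1 ?IH ?inE // /= /keep_choice mkseqS last_rcons IH.
have -> : pi n.+1.*2 = climb i.
  rewrite doubleS cons2 ?E ?inE // /= /count_choice mkseqS last_rcons E.
  by rewrite size_rcons size_mkseq -ei eqxx.
exact: climb_level.
Qed.

Lemma keep_count_reaches : ladder_objective P2 (outcome keep count v0).
Proof.
exists p.*2; rewrite inE; apply/eqP.
have [//|[i]] := keep_count_invariant p.
by have := ltn_ord i => /[swap] ->; rewrite ltnn.
Qed.

(** * The lower bound on memory *)

(* The height of s is irrelevant: no play reaching t visits s. *)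
Definition height (x : ladder_vertex) : nat :=
  match x with
  | inl (i, b) => i.*2 + b
  | inr b => if b then p.*2 else 0
  end.

Lemma height_edge x y : ladder_edge x y -> height y <= (height x).+1.
Proof. by case: x y => [[i [|]]|[|]] [[j [|]]|[|]] //=; lia. Qed.

(** Discrete intermediate values: the height starts at 0, rises by at most 1 per step and reaches
    2p, so it first exceeds 2i at the value 2i+1, which only [u_ i] has. *)
Lemma first_visit pi (i : 'I_p) : is_play ladder pi -> pi 0 = v0 ->
    ladder_objective P2 pi ->
  exists b, [/\ pi b.+1 = u_ i,
    forall m, i.*2 < height (pi m) -> b < m & 
    exists2 j : 'I_p, i <= j & pi b = v_ j].
Proof.
move=> play_pi pi0 [n0]; rewrite inE => /eqP pin0.
have ex : exists n, i.*2 < height (pi n).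
  by exists n0; rewrite pin0 /= ltn_double.
case: (ex_minnP ex) => -[|b]; first by rewrite pi0 /=; lia.
move=> hb minb; exists b.
have Eb : pi b.+1 = u_ i.
  have lowb : height (pi b) <= i.*2.
    by rewrite leqNgt; apply/negP => /minb; rewrite ltnn.
  have := height_edge (play_pi b); move: hb lowb.
  case: (pi b.+1) => [[j [|]]|[|]] /=; try lia.
  by move=> h1 h2 h3; congr (inl (_, _)); apply: val_inj => /=; lia.
split=> //; move: (play_pi b); rewrite Eb.
by case: (pi b) => [[j [|]]|b'] //= ij; exists j.
Qed.

Lemma nash_memory (s1 : strategy ladder_game P1) (s2 : strategy ladder_game P2) :
  nash v0 s1 s2 -> ladder_objective P2 (outcome s1 s2 v0) ->
  requires_memory s2 p.
Proof.
move=> [nash1 _] reach M indM.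
have [play_pi pi0 _ cons2] := outcome_spec s1 s2 v0.
set pi := outcome s1 s2 v0 in play_pi pi0 cons2 reach nash1.
have lose1 : ~ ladder_objective P1 pi.
  by case: reach => n; rewrite inE => /eqP e /(_ n); rewrite e !inE.
have /fin_all_exists [b bP] := fun i => first_visit i play_pi pi0 reach.
(* The state after reading [pi (b i)], just before [u_ i] is read. *)
pose state (i : 'I_p) := up_hat M (mkseq pi (b i).+1).
suff state_inj (i j : 'I_p) : i < j -> state i <> state j.
  rewrite -{1}(card_ord p); apply: (@leq_card _ _ state) => i j e.
  by case: (ltngtP i j) => [/state_inj|/state_inj/nesym|/val_inj].
move=> ij eq_state.
have [bi mini _] := bP i; have [bj _ [k jk bk]] := bP j.
have lt_ij : b i < b j.
  rewrite ltn_neqAle -ltnS mini ?bj /= ?andbT; last by lia.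
  by apply/eqP => e; move: bi ij; rewrite e bj => -[->]; rewrite ltnn.
(* The loop runs from [u_ i] to [v_ k], the vertex before [u_ j]; the drop back to [u_ i] is legal
   as i < j <= k. *)
have [||play_rho cons_rho] :=
    lasso_consistent indM play_pi cons2 lt_ij _ _ eq_state.
- by rewrite bk !inE.
- by rewrite bk bi /=; lia.
have [t1 out_t1] := consistent_outcome s1 play_rho cons_rho.
apply: (nash1 lose1 t1) => n; rewrite /= pi0 in out_t1; rewrite -out_t1 /=.
(* The deviation only uses positions of [pi] before this visit to [u_ j], and a sink there could not
   have been left. *)
have no_sink : pi (b j).+1 \notin sinks by rewrite bj !inE.
apply: contra no_sink; apply: (absorbing_after absorbing_sinks play_pi).
by rewrite ltnW // ltn_lasso // ltnS.
Qed.

End Ladder.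

Theorem proposition40 (p : nat) (hp : 0 < p) :
  exists (V : finType) (G : game V) (v : V),
    [/\ #|V| = 2 * p + 2,
        forall i : player, is_buchi G i /\ is_cobuchi G i,
        exists (s1 : strategy G P1) (s2 : strategy G P2),
          nash v s1 s2 /\ objective G P2 (outcome s1 s2 v)
      & forall (s1 : strategy G P1) (s2 : strategy G P2),
          nash v s1 s2 -> objective G P2 (outcome s1 s2 v) ->
          requires_memory s2 p].
Proof.
exists (ladder_vertex p), (ladder_game p), (v0 hp); split.
- exact: card_ladder_vertex.
- exact: ladder_buchi_cobuchi.
(* [P2] already wins, so only deviations of [P1] matter. *)
- have win2 := keep_count_reaches hp.
  exists (keep p), (count p); split=> //; split=> [_ t1|/(_ win2)//].
  exact: count_punishes.
- exact: nash_memory.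
Qed.
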